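(* Let $n\ge1$ and $1\le k\le n$, and let $(\mathcal C,\partial)$ be the chain complex defined below, supported on $\Pi(n,k)$. Then for each $i$, $H_i(\mathcal C,\partial;\mathbb Z)$ is a free abelian group with a basis given by the homology classes of the weakly increasing words of $\mathcal A(n,k)$ having rank $i$ (each of which is a cycle). Furthermore $$\sum_{i\ge0}\dim H_i(\mathcal C,\partial;\mathbb Z)\,q^i=\binom{n-1-\lfloor k/2\rfloor}{\lfloor (k-1)/2\rfloor}_{q^2}.$$
   Context: An RG-word of length $n$ with maximum letter $k$ is a word $w=w_1\cdots w_n$ of positive integers with $w_1=1$, $w_i\le\max(w_1,\dots,w_{i-1})+1$ for $2\le i\le n$, and $\max_iw_i=k$; $\mathcal R(n,k)$ is their set. $w$ is allowable if each even letter of $w$ occurs exactly once; $\mathcal A(n,k)$ is the set of allowable words. $\Pi(n,k)$ is the poset on $\mathcal R(n,k)$ generated by covers $v\lessdot w$ when $w$ arises from $v$ by increasing exactly one entry by $1$; it is graded with rank of $w$ equal to $\sum_iw_i-n-\binom k2$. The chain complex: $\mathcal C_i$ is the free abelian group with basis the rank-$i$ elements of $\Pi(n,k)$; for $w\in\mathcal R(n,k)$ let $E(w)=\{i: w_i\text{ is even and } w_j=w_i\text{ for some } j<i\}=\{i_1<\dots<i_r\}$, and set $\partial(w)=\sum_{j=1}^r(-1)^{j-1}\,w_1\cdots w_{i_j-1}(w_{i_j}-1)w_{i_j+1}\cdots w_n$ (extended linearly); $\partial^2=0$. The Gaussian binomial is $\binom{a}{b}_x=\frac{[a]_x!}{[b]_x![a-b]_x!}$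 with $[m]_x=1+x+\dots+x^{m-1}$, $[m]_x!=[1]_x\cdots[m]_x$; here $x=q^2$. *)

(* Defs.v *)
From HB Require Import structures.
From mathcomp Require Import all_boot all_order all_algebra.
From mathcomp Require Import boolp classical_sets.
Import GRing.Theory.

Set Implicit Arguments.
Unset Strict Implicit.
Unset Printing Implicit Defensive.

(* Positions are numbered from 0, so w_1 is the entry at position 0. *)

Definition maxletter (s : seq nat) : nat := \max_(a <- s) a.

Definition rgword (k : nat) (s : seq nat) : bool :=
  [&& all (leq 1) s, head 0 s == 1,
      all (fun i => nth 0 s i <= (maxletter (take i s)).+1)
          (iota 1 (size s).-1)
    & maxletter s == k].

Definition allowable_word (s : seq nat) : bool :=
  all (fun a => ~~ odd a ==> (count_mem a s == 1)) s.

(* R(n,k); bounding the letters by k in the carrier makes it a finite type. *)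
Definition RG (n k : nat) : finType :=
  {w : n.-tuple 'I_k.+1 | rgword k (map val w)}.

Definition letters n k (w : RG n k) : seq nat := map val (val w).

Definition allowable n k (w : RG n k) : bool := allowable_word (letters w).

Definition weakly_increasing n k (w : RG n k) : bool := sorted leq (letters w).

(* Covers of Pi(n,k): increase exactly one entry by 1. *)
Definition cover n k (v w : RG n k) : bool :=
  [exists i : 'I_n,
     letters w == set_nth 0 (letters v) i (nth 0 (letters v) i).+1].

(* The subtraction is never truncated, see sum_letters below. *)
Definition rk n k (w : RG n k) : nat := sumn (letters w) - n - 'C(k, 2).

Definition top_rank n k : nat := \max_(w : RG n k) rk w.

(* The increasing sequence i_1 < ... < i_r of the elements of E(w). *)
Definition E_positions (s : seq nat) : seq nat :=
  [seq i <- iota 0 (size s)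
     | ~~ odd (nth 0 s i) && (nth 0 s i \in take i s)].

Definition lower (i : nat) (s : seq nat) : seq nat :=
  take i s ++ (nth 0 s i).-1 :: drop i.+1 s.

Local Open Scope ring_scope.

(* The free abelian group on R(n,k), that is, the direct sum of all the C_i. *)
Definition chain (n k : nat) : zmodType := {ffun RG n k -> int}.

(* The basis element given by a word; it is 0 if s is not a word of R(n,k),
   which never happens for the words occurring in a boundary (lower_cover). *)
Definition elem n k (s : seq nat) : chain n k :=
  [ffun v : RG n k => (letters v == s)%:R].

Definition boundary_word n k (s : seq nat) : chain n k :=
  \sum_(j < size (E_positions s))
     elem n k (lower (nth 0%N (E_positions s) j) s) *~ (-1) ^+ j.

Definition boundary n k (c : chain n k) : chain n k :=
  \sum_(w : RG n k) boundary_word n k (letters w) *~ c w.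

(* Membership in C_i. *)
Definition homogeneous n k (i : nat) (c : chain n k) : bool :=
  [forall w : RG n k, (c w != 0) ==> (rk w == i)].

Definition is_cycle n k (i : nat) (c : chain n k) : bool :=
  homogeneous i c && (boundary c == 0).

Lemma homogeneousB n k i (c d : chain n k) :
  homogeneous i c -> homogeneous i d -> homogeneous i (c - d).
Proof.
move=> /forallP hc /forallP hd; apply/forallP => w; apply/implyP.
apply: contraNT => hw; rewrite !ffunE.
have /eqP-> : c w == 0 by apply: contraNT hw => /(implyP (hc w)).
have /eqP-> : d w == 0 by apply: contraNT hw => /(implyP (hd w)).
by rewrite subrr.
Qed.

Lemma homogeneous0 n k i : homogeneous i (0 : chain n k).
Proof. by apply/forallP => w; rewrite ffunE eqxx. Qed.

Lemma boundary_is_zmod_morphism n k : zmod_morphism (@boundary n k).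
Proof.
move=> c d; rewrite -sumrB; apply: eq_bigr => w _.
by rewrite !ffunE mulrzBr.
Qed.

HB.instance Definition _ n k :=
  GRing.isZmodMorphism.Build (chain n k) (chain n k) (@boundary n k)
    (@boundary_is_zmod_morphism n k).

Lemma is_cycle_zmod_closed n k i : zmod_closed (@is_cycle n k i).
Proof.
split=> [|c d]; first by apply/andP; split; rewrite ?homogeneous0 ?raddf0.
move=> /andP[hc /eqP bc] /andP[hd /eqP bd]; apply/andP; split.
  exact: homogeneousB.
by rewrite raddfB /= bc bd subrr.
Qed.

HB.instance Definition _ n k i :=
  GRing.isZmodClosed.Build (chain n k) (@is_cycle n k i)
    (@is_cycle_zmod_closed n k i).

Record cycle_group n k i := Cycle {
  cycle_chain :> chain n k;
  _ : is_cycle i cycle_chain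
}.

HB.instance Definition _ n k i := [isSub for @cycle_chain n k i].
HB.instance Definition _ n k i := [Choice of cycle_group n k i by <:].
HB.instance Definition _ n k i :=
  [SubChoice_isSubZmodule of cycle_group n k i by <:].

Definition is_boundary n k i (z : cycle_group n k i) : bool :=
  `[< exists2 b : chain n k, homogeneous i.+1 b & val z = boundary b >].

Lemma is_boundary_zmod_closed n k i : zmod_closed (@is_boundary n k i).
Proof.
split=> [|x y]; rewrite !unfold_in.
  by apply/asboolP; exists 0; rewrite ?homogeneous0 // !raddf0.
move=> /asboolP[b hb xb] /asboolP[c hc yc].
by apply/asboolP; exists (b - c); rewrite ?homogeneousB // !raddfB /= xb yc.
Qed.

HB.instance Definition _ n k i :=
  GRing.isZmodClosed.Build (cycle_group n k i) (@is_boundary n k i)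
    (@is_boundary_zmod_closed n k i).

Definition boundary_group n k i : zmodClosed (cycle_group n k i) :=
  GRing.ZmodClosed.clone (cycle_group n k i) (@is_boundary n k i) _.

Definition homology (n k i : nat) : zmodType :=
  Quotient.quot (boundary_group n k i).

Definition homology_class n k i (z : cycle_group n k i) : homology n k i :=
  (\pi_(Quotient.quot (boundary_group n k i)) z)%qT.

Definition is_Zbasis (I : finType) (V : zmodType) (e : I -> V) : Prop :=
  forall v : V, exists! c : {ffun I -> int}, v = \sum_(i : I) e i *~ c i.

(* The number of elements of a basis of V; 0 if V has no finite basis. *)
Definition free_rank (V : zmodType) : nat :=
  xget 0%N [set d : nat | exists e : 'I_d -> V, is_Zbasis e]%classic.

Definition incr_allowable (n k i : nat) : finType :=
  {w : RG n k | [&& allowable w, weakly_increasing w & rk w == i]}.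

Section Gaussian.
Variables (F : fieldType) (x : F).

Definition qint (m : nat) : F := \sum_(i < m) x ^+ i.

Definition qfact (m : nat) : F := \prod_(i < m) qint i.+1.

Definition gauss_binom (a b : nat) : F := qfact a / (qfact b * qfact (a - b)).

End Gaussian.

(* The indeterminate q, in the field of rational functions. *)
Definition q : {fraction {poly int}} := tofrac 'X.

(* H_i = 0 for i > top_rank n k, as C_i = 0. *)
Definition poincare_series (n k : nat) : {fraction {poly int}} :=
  \sum_(i < (top_rank n k).+1) (free_rank (homology n k i))%:R * q ^+ i.

Local Close Scope ring_scope.

Lemma size_letters n k (w : RG n k) : size (letters w) = n.
Proof. by rewrite size_map size_tuple. Qed.

Lemma rgword_sumn k s : rgword k s -> size s + 'C(k, 2) <= sumn s.
Proof.
case/and4P=> + + + /eqP<-.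
elim/last_ind: s => [|s a IH] // pos hd rg.
case: s => [|b s] in IH pos hd rg *.
  by move: hd => /= /eqP->; rewrite /maxletter big_seq1 bin_small.
have t_gt0 : 0 < size (b :: s) by [].
have {}hd : head 0 (b :: s) == 1 by [].
move: (b :: s) t_gt0 IH pos hd rg => {b s} t t_gt0 IH pos hd rg.
have {}rg i : 0 < i <= size t ->
    nth 0 (rcons t a) i <= (maxletter (take i t)).+1.
  move=> /andP[i_gt0 i_le]; have := allP rg i.
  rewrite mem_iota size_rcons i_gt0 add1n ltnS i_le => /(_ isT).
  by rewrite -{2}cats1 takel_cat.
move: pos; rewrite all_rcons => /andP[a_gt0 pos].
have {}IH : size t + 'C(maxletter t, 2) <= sumn t.
  apply: IH => //; apply/allP => i; rewrite mem_iota add1n prednK //.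
  move=> /andP[i_gt0 i_lt].
  by have := rg i; rewrite i_gt0 (ltnW i_lt) nth_rcons i_lt => /(_ isT).
have ha : a <= (maxletter t).+1.
  by have := rg (size t); rewrite t_gt0 leqnn nth_rcons ltnn eqxx take_size;
     apply.
have -> : maxletter (rcons t a) = maxn (maxletter t) a.
  by rewrite /maxletter -cats1 big_cat big_seq1.
rewrite size_rcons sumn_rcons; case: (leqP a (maxletter t)) => [_|lt_a].
  by rewrite addSn -addn1 leq_add.
have -> : a = (maxletter t).+1 by apply/eqP; rewrite eqn_leq ha lt_a.
by rewrite binS bin1 addSn addnA addnS ltnS leq_add.
Qed.

Lemma sum_letters n k (w : RG n k) :
  sumn (letters w) = n + 'C(k, 2) + rk w.
Proof.
rewrite /rk -subnDA subnKC //.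
by have := rgword_sumn (valP w); rewrite -/(letters w) size_letters.
Qed.

Lemma rk_cover n k (v w : RG n k) : cover v w -> rk w = (rk v).+1.
Proof.
case/existsP=> i /eqP eq_w; have := sum_letters w.
rewrite eq_w sumn_set_nth_ltn ?size_letters // sum_letters.
by move/eqP; rewrite addnS subSn ?leq_addl // addnK -addnS eqn_add2l => /eqP.
Qed.

Lemma rgword_lower k s i :
  rgword k s -> i \in E_positions s -> rgword k (lower i s).
Proof.
move=> rg; rewrite mem_filter mem_iota /= add0n.
move=> /andP[/andP[ev a_in] i_lt]; rewrite /lower.
have def_s : s = take i s ++ nth 0 s i :: drop i.+1 s.
  by rewrite -drop_nth // cat_take_drop.
have sz_u : size (take i s) = i by rewrite size_takel // ltnW.
move: rg ev a_in sz_u; rewrite [X in rgword k X]def_s.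
move: (take i s) (nth 0 s i) (drop i.+1 s) => u a v.
case/and4P=> pos hd rg /eqP mx ev a_u _.
have max_take j b : b <= a ->
  maxletter (take j (u ++ b :: v)) = maxletter (take j (u ++ a :: v)).
  move=> le_b; rewrite !take_cat; case: ltnP => // _.
  case: (j - size u) => [|m] //=; rewrite /maxletter !big_cat !big_cons /=.
  have le_u c : c <= a -> c <= \max_(x <- u) x.
    move=> le_c; apply: leq_trans le_c _.
    by apply: (@leq_bigmax_seq _ u xpredT id).
  by rewrite !maxnA (maxn_idPl (le_u _ le_b)) (maxn_idPl (le_u _ (leqnn a))).
have le_p := leq_pred a.
apply/and4P; split.
- move: pos; rewrite !all_cat /= => /and3P[-> a_gt0 ->]; rewrite andbT /=.
  by case: a ev a_gt0 {a_u max_take hd rg mx le_p} => [|[|a]].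
- by case: u a_u hd {pos rg mx max_take}.
- apply/allP => j; rewrite size_cat /= => j_in; rewrite max_take //.
  have := allP rg j; rewrite size_cat /= => /(_ j_in).
  apply: leq_trans; rewrite !nth_cat; case: ltnP => // _.
  by case: (j - size u).
- by rewrite -mx -[u ++ _]take_size -[u ++ a :: v]take_size !size_cat /= max_take.
Qed.

(* The words in the boundary of w are elements of Pi(n,k) covered by w. *)
Lemma lower_cover n k (w : RG n k) i :
  i \in E_positions (letters w) ->
  exists2 v : RG n k, letters v = lower i (letters w) & cover v w.
Proof.
move=> i_E; have rg := rgword_lower (valP w) i_E.
have [] : i < n /\ 0 < nth 0 (letters w) i.
  move: i_E; rewrite mem_filter mem_iota size_letters add0n => /andP[_ /= i_lt].
  split=> //; have /and4P[/allP pos _ _ _] := valP w.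
  by apply: pos; rewrite mem_nth ?size_letters.
move=> i_lt a_gt0; set s := lower i (letters w).
have sz_s : size s = n.
  rewrite size_cat /= size_drop size_takel ?size_letters ?(ltnW i_lt) //.
  by rewrite -subSn // subSS addnC subnK // ltnW.
have le_s a : a \in s -> a < k.+1.
  move=> a_s; have /and4P[_ _ _ /eqP<-] := rg.
  by rewrite ltnS; apply: (@leq_bigmax_seq _ _ xpredT id).
have mapK : map val (map (@inord k) s) = s.
  rewrite -map_comp -[RHS]map_id; apply/eq_in_map => a /le_s a_lt.
  by rewrite /= inordK.
have szP : size (map (@inord k) s) == n by rewrite size_map sz_s.
have rgP : rgword k (map val (val (Tuple szP))) by rewrite /= mapK.
exists (Sub (Tuple szP) rgP : RG n k).
  by rewrite /letters SubK /= mapK.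
apply/existsP; exists (Ordinal i_lt); rewrite /letters SubK /= mapK.
rewrite -/(letters w) /s /lower; apply/eqP.
have sz_u : size (take i (letters w)) = i.
  by rewrite size_takel // size_letters ltnW.
rewrite nth_cat sz_u ltnn subnn /= prednK // set_nthE size_cat sz_u /=.
rewrite addnS ltnS leq_addr take_cat sz_u ltnn subnn take0 cats0.
rewrite drop_cat sz_u ltnNge leqnSn /= subSn // subnn /= drop0.
by rewrite -drop_nth ?size_letters // cat_take_drop.
Qed.

(* Main.v *)
Require Import Defs.
From HB Require Import structures.
From mathcomp Require Import all_boot all_order all_algebra.
From mathcomp Require Import boolp classical_sets.
From mathcomp Require Import ring zify.
Import GRing.Theory.

Set Implicit Arguments.
Unset Strict Implicit.
Unset Printing Implicit Defensive.

(* Call a position bad when its letter is repeated and is not an odd letter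
   equal to the maximum of the prefix before it. At a bad position the letters
   2j-1 and 2j can be exchanged without changing any prefix maximum, hence
   without changing the set of bad positions. Raising the odd letter at the
   first bad position (and killing the word if that letter is even or if there
   is no bad position) is a contracting homotopy onto the span of the words
   with no bad position: no element of E(w) precedes the first bad position, so
   the signs cancel. A word has no bad position iff it is allowable and weakly
   increasing, and no such word occurs in a boundary. For the Poincare series,
   deleting the last letter of such a word gives the q-Pascal recurrence. *)


(** * Prefix maxima and bad positions *)

Definition premax (s : seq nat) (i : nat) : nat := maxletter (take i s).

Definition bad (s : seq nat) (i : nat) : bool :=
  [&& i < size s, nth 0 s i <= premax s i
    & ~~ odd (nth 0 s i) || (nth 0 s i < premax s i)].

Definition flip (i : nat) (s : seq nat) : seq nat :=
  set_nth 0 s i (if odd (nth 0 s i) then (nth 0 s i).+1 else (nth 0 s i).-1).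

(** Critical in the sense of discrete Morse theory: these words are left unmatched when words are
    paired by the exchange at their first bad position. *)
Definition critical (s : seq nat) : bool := ~~ has (bad s) (iota 0 (size s)).

Lemma premaxS s i : i < size s -> premax s i.+1 = maxn (premax s i) (nth 0 s i).
Proof.
by move=> i_lt; rewrite /premax (take_nth 0) // /maxletter -cats1 big_cat big_seq1.
Qed.

Lemma leq_premax s i j : i <= j -> premax s i <= premax s j.
Proof.
move=> le_ij; rewrite /premax -(subnKC le_ij) takeD /maxletter big_cat.
exact: leq_maxl.
Qed.

Lemma nth_leq_premax s i j : i < j -> i < size s -> nth 0 s i <= premax s j.
Proof.
move=> ij i_lt; apply: leq_trans (leq_premax s ij).
by rewrite premaxS // leq_maxr.
Qed.

(** The condition on the first letter becomes the case [i = 0], where the prefix maximum is 0. *)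
Lemma rgwordP k s : 0 < size s ->
  reflect [/\ forall i, i < size s -> 0 < nth 0 s i <= (premax s i).+1
            & premax s (size s) = k] (rgword k s).
Proof.
move=> s_gt0; apply: (iffP and4P) => [[/all_nthP pos hd /allP rg /eqP mx]|].
  split=> [i i_lt|]; last by rewrite /premax take_size.
  rewrite pos //=; case: i i_lt => [|i] i_lt.
    by case: s hd {s_gt0 rg pos mx i_lt} => //= a s /eqP ->.
  by apply: rg; rewrite mem_iota add1n prednK.
case=> rg mx; split.
- by apply/(all_nthP 0) => i /rg /andP[].
- have := rg 0 s_gt0; rewrite /premax take0 /maxletter big_nil nth0.
  by case: (head 0 s) => [|[|a]].
- by apply/allP=> i; rewrite mem_iota add1n prednK // => /andP[_ /rg /andP[]].
- by rewrite -mx /premax take_size.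
Qed.

(** The prefix maximum grows by at most one at each step, so no value below it is skipped. Being
    repeated thus becomes a comparison with the prefix maximum. *)
Lemma mem_prefix k s i a : rgword k s -> i <= size s ->
  (a \in take i s) = (0 < a <= premax s i).
Proof.
case: s => [|b s]; first by rewrite /premax /maxletter !big_nil; case: a.
set t := b :: s => /rgwordP-/(_ isT)[rg _]; elim: i => [|i IH] i_lt.
  by rewrite /premax take0 /maxletter big_nil; case: a.
rewrite (take_nth 0) // mem_rcons in_cons (IH (ltnW i_lt)) premaxS //.
have /andP[] := rg i i_lt; rewrite leq_max; move: (nth 0 t i) (premax t i).
move=> c m c_gt0 c_le; case: eqP => [->|/eqP ne] /=; first by rewrite c_gt0 leqnn orbT.
case: (0 < a) => //=; case: leqP => //= lt_m; symmetry; apply/negbTE.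
by rewrite -ltnNge ltn_neqAle eq_sym ne (leq_trans c_le).
Qed.

(** For an even letter, [bad] only asks that it be at most the prefix maximum, which by [mem_prefix]
    means that it occurs earlier. *)
Lemma E_positionsE k s : rgword k s ->
  E_positions s = [seq i <- iota 0 (size s) | bad s i & ~~ odd (nth 0 s i)].
Proof.
move=> rg; apply: eq_in_filter => i; rewrite mem_iota => /andP[_ i_lt].
rewrite (mem_prefix _ rg) ?(ltnW i_lt) // /bad i_lt /= andbC.
have /and4P[/allP pos _ _ _] := rg; rewrite (pos _ (mem_nth _ i_lt)) /=.
by case: odd; rewrite ?andbF ?andbT.
Qed.

Lemma lowerE s i : bad s i -> ~~ odd (nth 0 s i) -> lower i s = flip i s.
Proof.
case/andP=> i_lt _ ev.
by rewrite /lower /flip (negbTE ev) set_nthE i_lt.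
Qed.

(** * The exchange of letters at a bad position *)

Section Flip.

Variables (k : nat) (s : seq nat) (i : nat).
Hypotheses (rg : rgword k s) (bad_i : bad s i).

Let i_lt : i < size s. Proof. by case/and3P: bad_i. Qed.
Let s_gt0 : 0 < size s. Proof. exact: leq_ltn_trans i_lt. Qed.

Lemma bad_nth_gt0 : 0 < nth 0 s i.
Proof. by have /andP[] := (proj1 (rgwordP k s_gt0 rg)) i i_lt. Qed.

Lemma size_flip : size (flip i s) = size s.
Proof. by rewrite size_set_nth; apply/maxn_idPr. Qed.

Lemma nth_flip j : nth 0 (flip i s) j =
  if j == i then if odd (nth 0 s i) then (nth 0 s i).+1 else (nth 0 s i).-1
  else nth 0 s j.
Proof. by rewrite nth_set_nth. Qed.

Lemma odd_flip j : odd (nth 0 (flip i s) j) = (j == i) (+) odd (nth 0 s j).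
Proof.
rewrite nth_flip; case: eqP => [->|//]; have := bad_nth_gt0.
by case: (nth 0 s i) => //= m _; case od: (odd m); rewrite /= ?od.
Qed.

Lemma flip_gt0 : 0 < nth 0 (flip i s) i.
Proof.
rewrite nth_flip eqxx; have := bad_nth_gt0.
by case: ifP => //; case: (nth 0 s i) => [|[|m]].
Qed.

(** An odd letter at a bad position lies strictly below the prefix maximum, so there is room to
    raise it. *)
Lemma flip_leq_premax : nth 0 (flip i s) i <= premax s i.
Proof.
rewrite nth_flip eqxx; case/and3P: bad_i => _ le_m; case: ifP => //= _ _.
exact: leq_trans (leq_pred _) le_m.
Qed.

(** Both the old and the new letter at [i] are at most the maximum of the prefix before them, so
    neither affects a later maximum. *)
Lemma premax_flip j : premax (flip i s) j = premax s j.
Proof.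
wlog le_s : j / j <= size s => [IH|].
  have [|/ltnW lt_s] := leqP j (size s); first exact: IH.
  rewrite /premax !take_oversize ?size_flip // -[flip i s]take_size -[in RHS](take_size s).
  by rewrite size_flip; apply: IH.
elim: j le_s => [|m IH] m_lt; first by rewrite /premax !take0.
rewrite !premaxS ?size_flip // IH ?(ltnW m_lt) // nth_flip; case: eqP => // ->.
have := flip_leq_premax; rewrite nth_flip eqxx => /maxn_idPl ->.
by symmetry; apply/maxn_idPl; case/and3P: bad_i.
Qed.

(** Elsewhere the letter and its prefix maximum are unchanged. At [i], a raised letter becomes even,
    and a lowered one ends strictly below the prefix maximum. *)
Lemma bad_flip j : bad (flip i s) j = bad s j.
Proof.
rewrite /bad size_flip premax_flip; have [->|ne] := eqVneq j i; last first.
  by rewrite nth_flip (negbTE ne).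
rewrite flip_leq_premax odd_flip eqxx /= negbK.
case/and3P: bad_i => -> le_m; rewrite le_m /= nth_flip eqxx.
case: (odd _) => //= _; have := bad_nth_gt0.
by case: (nth 0 s i) le_m => //= m ->.
Qed.

Lemma rgword_flip : rgword k (flip i s).
Proof.
have [rg1 mx] := rgwordP k s_gt0 rg.
apply/rgwordP; rewrite ?size_flip //; split; last by rewrite premax_flip.
move=> j j_lt; rewrite premax_flip; have [->|ne] := eqVneq j i.
  by rewrite flip_gt0 (leq_trans flip_leq_premax).
by rewrite nth_flip (negbTE ne) rg1.
Qed.

Lemma flipK : flip i (flip i s) = s.
Proof.
have sz : size (flip i (flip i s)) = size s.
  by rewrite size_set_nth size_flip; apply/maxn_idPr.
apply: (@eq_from_nth _ 0) => // j _; rewrite nth_set_nth /=.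
rewrite odd_flip eqxx /= !nth_flip eqxx; case: eqP => // ->.
by case: (odd _); rewrite //= prednK // bad_nth_gt0.
Qed.

Lemma flipC j : j != i -> j < size s -> flip j (flip i s) = flip i (flip j s).
Proof.
move=> ne j_lt; have szj t : size t = size s -> size (flip j t) = size s.
  by move=> st; rewrite size_set_nth st; apply/maxn_idPr.
have szi t : size t = size s -> size (flip i t) = size s.
  by move=> st; rewrite size_set_nth st; apply/maxn_idPr.
apply: (@eq_from_nth _ 0) => [|l _]; first by rewrite szj ?szi ?szj.
have := negbTE ne; rewrite !nth_set_nth /= (eq_sym i) => -> /=.
rewrite !nth_set_nth /=; case: (eqVneq l j) ne => [->|//] /negbTE -> //.
Qed.

End Flip.

(** * Critical words are the allowable weakly increasing ones *)

Lemma criticalP s : reflect (forall i, ~~ bad s i) (critical s).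
Proof.
apply: (iffP hasPn) => [crit i|crit i _ //]; apply/negP => bad_i.
have/crit: i \in iota 0 (size s) by rewrite mem_iota; case/andP: bad_i.
by rewrite bad_i.
Qed.

(** No position is bad iff every letter is at least its prefix maximum, strictly so when even. The
    weak inequality gives monotonicity, the strict one the uniqueness of even letters. *)
Lemma critical_rgword k s : rgword k s ->
  critical s = allowable_word s && sorted leq s.
Proof.
case: (posnP (size s)) => [/size0nil->|s_gt0] // rg0.
have [rg mx] := rgwordP k s_gt0 rg0.
apply/criticalP/andP => [crit|[al so] i]; last first.
  apply/negP => /and3P[i_lt le_m].
  have mem_i: nth 0 s i \in take i s.
    by rewrite (mem_prefix _ rg0) ?(ltnW i_lt) // le_m; case/andP: (rg i i_lt) => ->.
  (* By monotonicity a bad letter equals its prefix maximum, so it must be even; but it also occurs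
     earlier, against allowability. *)
  have premax_le: premax s i <= nth 0 s i.
    rewrite /premax /maxletter; apply/bigmax_leqP_seq => a a_in _.
    have j_lt: index a (take i s) < i.
      by move: a_in; rewrite -index_mem size_takel // ltnW.
    rewrite -[a](nth_index 0 a_in) nth_take //.
    apply: (sorted_leq_nth leq_trans leqnn 0 so) => //; last exact: ltnW.
    by rewrite inE (ltn_trans j_lt).
  rewrite ltnNge premax_le orbF => ev.
  have /implyP/(_ ev) := allP al _ (mem_nth 0 i_lt).
  rewrite -{2}[s](cat_take_drop i) (drop_nth 0) // count_cat /= eqxx.
  have : 0 < count_mem (nth 0 s i) (take i s) by rewrite -has_count has_pred1.
  by case: (count _ _) => // c _; rewrite addnCA.
have ge_premax i : i < size s -> premax s i <= nth 0 s i.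
  move=> i_lt; have := crit i; rewrite /bad i_lt /=.
  by rewrite negb_and negb_or -ltnNge -leqNgt => /orP[/ltnW //|/andP[]].
split; last first.
  apply/(sortedP 0) => i i_lt; apply: leq_trans (ge_premax _ i_lt).
  by rewrite nth_leq_premax // ltnW.
apply/allP => a a_in; apply/implyP => ev.
move: a_in; rewrite -has_pred1 has_count => c_gt0.
rewrite eqn_leq c_gt0 andbT leqNgt; apply/negP => c_gt1.
have a_in : a \in s by rewrite -has_pred1 has_count.
have i_lt : index a s < size s by rewrite index_mem.
(* A second occurrence of the even letter [a], sought after the first, is at most its prefix maximum
   and hence bad. *)
have : a \in drop (index a s).+1 s.
  move: c_gt1; rewrite -has_pred1 has_count.
  rewrite -{1}[s](cat_take_drop (index a s)) (drop_nth 0) // count_cat /=.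
  rewrite nth_index // eqxx.
  have -> : count_mem a (take (index a s) s) = 0; last by rewrite add0n add1n.
  by apply/count_memPn; rewrite in_take_leq ?ltnn //; apply: ltnW.
move=> a_in2; have j_lt: index a (drop (index a s).+1 s) < size (drop (index a s).+1 s).
  by rewrite index_mem.
set j := (index a s).+1 + index a (drop (index a s).+1 s).
have j_nth : nth 0 s j = a by rewrite /j -nth_drop nth_index.
have js : j < size s by rewrite /j -ltn_subRL -size_drop.
have := crit j; rewrite /bad js j_nth ev andbT /= -ltnNge ltnNge => /negP; apply.
rewrite -{1}(nth_index 0 a_in); apply: nth_leq_premax => //.
by rewrite /j addSn ltnS leq_addr.
Qed.

Local Open Scope ring_scope.

(** * Alternating sums and the first bad position *)

Lemma letters_inj n k : injective (@letters n k).
Proof. by move=> v w /(inj_map val_inj)/val_inj/val_inj. Qed.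

Lemma letters_surj n k s : rgword k s -> size s = n ->
  exists w : RG n k, letters w = s.
Proof.
move=> rg sz_s; have le_s a : a \in s -> (a < k.+1)%N.
  move=> a_s; have /and4P[_ _ _ /eqP<-] := rg.
  by rewrite ltnS; apply: (@leq_bigmax_seq _ _ xpredT id).
have mapK : map val (map (@inord k) s) = s.
  rewrite -map_comp -[RHS]map_id; apply/eq_in_map => a /le_s a_lt.
  by rewrite /= inordK.
have szP : size (map (@inord k) s) == n by rewrite size_map sz_s.
have rgP : rgword k (map val (val (Tuple szP))) by rewrite /= mapK.
by exists (Sub (Tuple szP) rgP : RG n k); rewrite /letters SubK /= mapK.
Qed.

Lemma rgword_letters n k (w : RG n k) : rgword k (letters w).
Proof. exact: valP w. Qed.

(** The sign depends on the index in the list of positions. Splitting off the first position negates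
    the rest, which is all the sign bookkeeping needed below. *)
Definition altsum (V : zmodType) (f : nat -> V) (l : seq nat) : V :=
  \sum_(j < size l) f (nth 0%N l j) *~ (-1) ^+ j.

Lemma altsum_cons (V : zmodType) (f : nat -> V) i l :
  altsum f (i :: l) = f i - altsum f l.
Proof.
rewrite /altsum big_ord_recl /= mulr1z -sumrN; congr (_ + _).
by apply: eq_bigr => j _; rewrite exprS mulN1r mulrNz.
Qed.

Lemma eq_altsum (V : zmodType) (f g : nat -> V) l :
  {in l, f =1 g} -> altsum f l = altsum g l.
Proof. by move=> fg; apply: eq_bigr => j _; rewrite fg ?mem_nth. Qed.

Lemma raddf_altsum (U V : zmodType) (h : {additive U -> V}) f l :
  h (altsum f l) = altsum (h \o f) l.
Proof. by rewrite raddf_sum; apply: eq_bigr => j _; rewrite raddfMz. Qed.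

Lemma altsum0 (V : zmodType) (f : nat -> V) l :
  {in l, forall i, f i = 0} -> altsum f l = 0.
Proof. by move=> f0; apply: big1 => j _; rewrite f0 ?mem_nth // mul0rz. Qed.

Lemma boundary_wordE n k s : rgword k s ->
  boundary_word n k s = altsum (fun i => elem n k (flip i s)) (E_positions s).
Proof.
move=> rg; apply: (@eq_altsum _ (fun i => elem n k (lower i s))) => i.
by rewrite (E_positionsE rg) mem_filter => /andP[/andP[bad_i ev] _]; rewrite lowerE.
Qed.

(** For a critical word this is the length of the word. *)
Definition first_bad (s : seq nat) : nat := find (bad s) (iota 0 (size s)).

Lemma first_badP s : ~~ critical s ->
  bad s (first_bad s) /\ forall i, (i < first_bad s)%N -> ~~ bad s i.
Proof.
rewrite negbK => nc; have := nc; rewrite has_find size_iota => lt_s.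
split=> [|i i_lt]; first by have := nth_find 0%N nc; rewrite nth_iota.
by have := before_find 0%N i_lt; rewrite nth_iota ?add0n ?(ltn_trans i_lt) // => ->.
Qed.

Section Flip_bad.

Variables (k : nat) (s : seq nat) (i : nat).
Hypotheses (rg : rgword k s) (bad_i : bad s i).

Lemma critical_flip : critical (flip i s) = critical s.
Proof.
rewrite /critical (size_flip bad_i); congr (~~ _).
by apply: eq_has => j; rewrite (bad_flip rg).
Qed.

Lemma first_bad_flip : first_bad (flip i s) = first_bad s.
Proof.
rewrite /first_bad (size_flip bad_i).
by apply: eq_find => j; rewrite (bad_flip rg).
Qed.

End Flip_bad.

Definition late_positions (s : seq nat) : seq nat :=
  [seq i <- iota (first_bad s).+1 (size s - (first_bad s).+1)
     | bad s i & ~~ odd (nth 0%N s i)].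

Lemma mem_late_positions s i : i \in late_positions s ->
  [/\ bad s i, ~~ odd (nth 0%N s i) & i != first_bad s].
Proof.
rewrite mem_filter mem_iota => /andP[/andP[-> ->] /andP[lt_i _]].
by split=> //; rewrite gtn_eqF.
Qed.

(** Nothing before the first bad position is in E, and that position itself is in E exactly when its
    letter is even. *)
Lemma E_positions_first k s : rgword k s -> ~~ critical s ->
  E_positions s = if odd (nth 0%N s (first_bad s)) then late_positions s
                  else first_bad s :: late_positions s.
Proof.
move=> rg nc; have [bad_p min_p] := first_badP nc.
have p_lt : (first_bad s < size s)%N by case/and3P: bad_p.
rewrite (E_positionsE rg) -{1}(subnKC (ltnW p_lt)) iotaD filter_cat.
rewrite (_ : filter _ (iota 0 _) = [::]) ?cat0s; last first.
  apply/eqP; rewrite -[_ == _]negbK -has_filter; apply/hasPn => i.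
  by rewrite mem_iota => /min_p /negbTE ->.
by rewrite add0n -(subnSK p_lt) /= bad_p; case: odd.
Qed.

(** Two words paired at their first bad position share the later part of E, so the remaining
    boundary terms correspond one to one. *)
Lemma late_positions_flip k s : rgword k s -> ~~ critical s ->
  late_positions (flip (first_bad s) s) = late_positions s.
Proof.
move=> rg nc; have [bad_p _] := first_badP nc.
rewrite /late_positions (first_bad_flip rg) // size_flip //.
apply: eq_in_filter => i; rewrite mem_iota => /andP[lt_i _].
by rewrite (bad_flip rg) // (odd_flip rg) // gtn_eqF.
Qed.

(** * The contracting homotopy *)

Section Homotopy.

Variables n k : nat.

Definition homotopy_word (s : seq nat) : chain n k :=
  if ~~ critical s && odd (nth 0%N s (first_bad s))
  then elem n k (flip (first_bad s) s) else 0.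

Definition homotopy (c : chain n k) : chain n k :=
  \sum_(w : RG n k) homotopy_word (letters w) *~ c w.

Lemma homotopy_is_zmod_morphism : zmod_morphism homotopy.
Proof.
move=> c d; rewrite -sumrB; apply: eq_bigr => w _.
by rewrite !ffunE mulrzBr.
Qed.

HB.instance Definition _ := GRing.isZmodMorphism.Build (chain n k) (chain n k)
  homotopy homotopy_is_zmod_morphism.

Lemma elemE (v w : RG n k) : elem n k (letters w) v = (v == w)%:R.
Proof. by rewrite ffunE (inj_eq (@letters_inj n k)). Qed.

Lemma sum_elem (V : zmodType) (F : RG n k -> V) (w : RG n k) :
  \sum_v F v *~ elem n k (letters w) v = F w.
Proof.
rewrite (bigD1 w) //= elemE eqxx mulr1z big1 ?addr0 // => v /negbTE ne.
by rewrite elemE ne mulr0z.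
Qed.

Lemma chain_elem (c : chain n k) : c = \sum_w elem n k (letters w) *~ c w.
Proof.
apply/ffunP => v; rewrite sum_ffunE (bigD1 v) //= big1 ?addr0 => [|w ne].
  by rewrite ffunMzE elemE eqxx intz.
by rewrite ffunMzE elemE eq_sym (negbTE ne) mul0rz.
Qed.

Lemma raddf_chain (V : zmodType) (f : {additive chain n k -> V}) c :
  f c = \sum_w f (elem n k (letters w)) *~ c w.
Proof.
rewrite {1}[c]chain_elem raddf_sum.
by apply: eq_bigr => w _; rewrite raddfMz.
Qed.

Lemma boundary_elem s : rgword k s -> size s = n ->
  boundary (elem n k s) = boundary_word n k s.
Proof. by move=> rg /(letters_surj rg)[w <-]; apply: sum_elem. Qed.

Lemma homotopy_elem s : rgword k s -> size s = n ->
  homotopy (elem n k s) = homotopy_word s.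
Proof.
move=> rg /(letters_surj rg)[w <-].
exact: (sum_elem (fun w => homotopy_word (letters w))).
Qed.

Lemma boundary_word_critical s : rgword k s -> critical s -> boundary_word n k s = 0.
Proof.
move=> rg /criticalP crit; rewrite boundary_wordE // altsum0 // => i.
by rewrite (E_positionsE rg) mem_filter (negbTE (crit i)).
Qed.

Lemma homotopy_formula_elem s : rgword k s -> size s = n ->
  boundary (homotopy (elem n k s)) + homotopy (boundary (elem n k s))
    = elem n k s *+ ~~ critical s.
Proof.
move=> rg sz; rewrite homotopy_elem // boundary_elem //.
case crit: (critical s).
  by rewrite boundary_word_critical // /homotopy_word crit !raddf0 addr0.
have nc : ~~ critical s by rewrite crit.
have [bad_p _] := first_badP nc; set p := first_bad s in bad_p *.
have rgp := rgword_flip rg bad_p.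
have homotopy_flip i : bad s i -> homotopy (elem n k (flip i s)) = homotopy_word (flip i s).
  by move=> bad_i; rewrite homotopy_elem ?size_flip ?(rgword_flip rg).
have homotopy_late i : i \in late_positions s -> homotopy (elem n k (flip i s)) =
    if odd (nth 0%N s p) then elem n k (flip p (flip i s)) else 0.
  case/mem_late_positions=> bad_i _ ne; rewrite homotopy_flip //.
  rewrite /homotopy_word (critical_flip rg) // (first_bad_flip rg) // crit /=.
  by rewrite (odd_flip rg) // -/p eq_sym (negbTE ne).
rewrite (boundary_wordE _ rg) (E_positions_first rg nc) -/p raddf_altsum mulr1n.
case: ifP homotopy_late => odd_p homotopy_late.
  (* Odd letter at [p]: the boundary of the raised word is [s] minus an alternating sum over the
     later positions, and [homotopy (boundary s)] is that same sum, because exchanges at distinct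
     positions commute. *)
  rewrite /homotopy_word crit odd_p boundary_elem ?size_flip // boundary_wordE //.
  rewrite (E_positions_first rgp) ?(critical_flip rg) // (first_bad_flip rg) // -/p.
  rewrite (odd_flip rg) // eqxx odd_p (late_positions_flip rg) // altsum_cons.
  rewrite (flipK rg) // -addrA -[RHS]addr0; congr (_ + _).
  apply/eqP; rewrite addrC subr_eq0; apply/eqP.
  apply: eq_altsum => i i_late; rewrite /= homotopy_late //.
  have [bad_i _ ne] := mem_late_positions i_late.
  by rewrite (flipC bad_p) //; case/and3P: bad_i.
(* Even letter at [p]: the later boundary terms keep this even letter and are killed, while the
   first term is raised back to [s]. *)
rewrite altsum_cons /= altsum0 => [|i i_late]; last exact: homotopy_late.
rewrite homotopy_flip // /homotopy_word crit odd_p raddf0 add0r subr0.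
rewrite (critical_flip rg) // (first_bad_flip rg) // -/p crit (odd_flip rg) //.
by rewrite eqxx odd_p (flipK rg).
Qed.

Lemma homotopy_formula (c : chain n k) :
  boundary (homotopy c) + homotopy (boundary c)
    = \sum_(w | ~~ critical (letters w)) elem n k (letters w) *~ c w.
Proof.
have /= -> := raddf_chain (@boundary n k \o homotopy) c.
have /= -> := raddf_chain (homotopy \o @boundary n k) c.
rewrite -big_split [RHS]big_mkcond /=.
apply: eq_bigr => w _; rewrite -mulrzDl homotopy_formula_elem ?size_letters ?rgword_letters //.
by case: critical; rewrite ?mul0rz.
Qed.

(** Each word in a boundary comes from an exchange at a bad position, and that position stays
    bad. *)
Lemma boundary_critical (c : chain n k) (v : RG n k) :
  critical (letters v) -> boundary c v = 0.
Proof.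
move=> crit; rewrite sum_ffunE big1 // => w _; rewrite ffunMzE.
have rg := rgword_letters w.
rewrite boundary_wordE // sum_ffunE big1 ?mul0rz // => j _; rewrite ffunMzE ffunE.
have := mem_nth 0%N (ltn_ord j); move: (nth 0%N _ _) => i.
rewrite [X in i \in X](E_positionsE rg) mem_filter => /andP[/andP[bad_i _] _].
case: eqP crit => [->|_]; last by rewrite mul0rz.
rewrite (critical_flip rg bad_i) => /criticalP noncrit.
by rewrite (negbTE (noncrit _)) in bad_i.
Qed.

Lemma homogeneous_elem (w : RG n k) : homogeneous (rk w) (elem n k (letters w)).
Proof.
by apply/forallP => v; rewrite elemE; have [->|] := eqVneq v w; rewrite eqxx.
Qed.

Lemma rk_flip (v w : RG n k) i : bad (letters w) i -> odd (nth 0%N (letters w) i) ->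
  letters v = flip i (letters w) -> rk v = (rk w).+1.
Proof.
case/andP=> i_lt _ odd_i def_v; apply: rk_cover; rewrite size_letters in i_lt.
by apply/existsP; exists (Ordinal i_lt); rewrite def_v /flip odd_i.
Qed.

Lemma homogeneous_homotopy i (c : chain n k) :
  homogeneous i c -> homogeneous i.+1 (homotopy c).
Proof.
move=> /forallP hc; apply/forallP => v; apply/implyP; apply: contraNT => ne.
rewrite sum_ffunE big1 // => w _; rewrite ffunMzE /homotopy_word.
case: ifP => [/andP[nc odd_p]|_]; last by rewrite ffunE mul0rz.
rewrite ffunE; case: eqP => [def_v|_]; last by rewrite mul0rz.
have [bad_p _] := first_badP nc.
have rk_v := rk_flip bad_p odd_p def_v; have /implyP := hc w.
by case: eqVneq => [->|_ /(_ isT) /eqP rk_w] //; rewrite rk_v rk_w eqxx in ne.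
Qed.

End Homotopy.

(** * The basis of homology *)

Section Homology.

Variables n k i : nat.

Lemma homology_class_is_zmod_morphism : zmod_morphism (@homology_class n k i).
Proof. by move=> x y; rewrite /homology_class raddfB. Qed.

HB.instance Definition _ := GRing.isZmodMorphism.Build (cycle_group n k i)
  (homology n k i) (@homology_class n k i) homology_class_is_zmod_morphism.

Lemma homology_class_eq0 (z : cycle_group n k i) :
  homology_class z = 0 <-> exists2 b, homogeneous i.+1 b & val z = boundary b.
Proof.
have -> : (homology_class z = 0) <-> is_boundary z.
  rewrite -(raddf0 (@homology_class n k i)); split=> [/eqP|bz].
    by rewrite -Quotient.idealrBE subr0.
  by apply/eqP; rewrite -Quotient.idealrBE subr0.
by split=> [/asboolP|bz] //; apply/asboolP.
Qed.

(** For a cycle, the homotopy formula exhibits its noncritical part as a boundary; homogeneity and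
    the assumption remove the critical part. *)
Lemma cycle_eq_boundary (z : chain n k) : is_cycle i z ->
  (forall w, critical (letters w) -> rk w = i -> z w = 0) ->
  z = boundary (homotopy z).
Proof.
move=> /andP[/forallP hz /eqP bz] z0.
have := homotopy_formula z; rewrite bz raddf0 addr0 => ->.
rewrite [LHS]chain_elem (bigID (fun w => critical (letters w))) /= big1 ?add0r //.
move=> w crit; have [->|/eqP ne] := eqVneq (z w) 0; first by rewrite mulr0z.
have /implyP/(_ (introN eqP ne))/eqP := hz w.
by move=> rk_w; case: ne; apply: z0.
Qed.

Lemma incr_allowableE (w : RG n k) :
  [&& allowable w, weakly_increasing w & rk w == i]
    = critical (letters w) && (rk w == i).
Proof. by rewrite andbA (critical_rgword (rgword_letters w)). Qed.

Lemma is_cycle_incr (w : incr_allowable n k i) :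
  is_cycle i (elem n k (letters (val w))).
Proof.
case: w => w /=; rewrite incr_allowableE => /andP[crit /eqP <-].
rewrite /is_cycle homogeneous_elem boundary_elem ?size_letters ?rgword_letters //.
by rewrite boundary_word_critical ?rgword_letters ?eqxx.
Qed.

Lemma homology_basis
    (P : forall w : incr_allowable n k i, is_cycle i (elem n k (letters (val w)))) :
  is_Zbasis (fun w => homology_class (Cycle (P w))).
Proof.
pose comb (c : {ffun incr_allowable n k i -> int}) : cycle_group n k i :=
  \sum_w Cycle (P w) *~ c w.
have combE c w : val (comb c) (val w) = c w.
  have -> : val (comb c) = \sum_u elem n k (letters (val u)) *~ c u.
    rewrite raddf_sum; apply: eq_bigr => u _.
    exact: (raddfMz (val : {additive cycle_group n k i -> chain n k})).
  rewrite sum_ffunE (bigD1 w) //= ffunMzE elemE eqxx intz big1 ?addr0 // => u ne.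
  by rewrite ffunMzE elemE (inj_eq val_inj) eq_sym (negbTE ne) mul0rz.
have class_comb (c : {ffun _ -> int}) :
    \sum_w homology_class (Cycle (P w)) *~ c w = homology_class (comb c).
  by rewrite raddf_sum; apply: eq_bigr => w _; rewrite raddfMz.
move=> v; elim/quotW: v => z.
(* The coordinates of a class are the coefficients of any representing cycle at the critical words
   of rank [i]. The difference from the combination has none left, so it bounds. *)
exists [ffun w => val z (val w)]; split=> [|c].
  rewrite class_comb; apply/eqP; rewrite -subr_eq0 -raddfB; apply/eqP.
  apply/homology_class_eq0; set c := finfun _; have cyc := valP (z - comb c).
  exists (homotopy (val (z - comb c))).
    by apply: homogeneous_homotopy; case/andP: cyc.
  apply: cycle_eq_boundary => // w crit /eqP rk_w.
  have wP : [&& allowable w, weakly_increasing w & rk w == i].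
    by rewrite incr_allowableE crit.
  rewrite raddfB ffunE ffunE; apply/eqP; rewrite subr_eq0.
  by rewrite -[w]/(val (Sub w wP : incr_allowable n k i)) combE ffunE.
(* Uniqueness: the difference is a boundary, so its critical coefficients vanish. *)
rewrite class_comb => /eqP; rewrite -subr_eq0 -raddfB => /eqP/homology_class_eq0[b _ def_b].
apply/ffunP => w; rewrite ffunE.
have /eqP : val (z - comb c) (val w) = 0.
  by rewrite def_b boundary_critical //; have := valP w; rewrite incr_allowableE => /andP[].
by rewrite raddfB ffunE ffunE combE subr_eq0 => /eqP.
Qed.

End Homology.

(** * Invariance of the rank *)

Lemma is_Zbasis_reindex (I J : finType) (V : zmodType) (e : I -> V) (f : J -> I) :
  bijective f -> is_Zbasis e -> is_Zbasis (e \o f).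
Proof.
case=> g fK gK basis v; have [c [def_v c_uniq]] := basis v.
exists [ffun j => c (f j)]; split=> [|d def_d].
  rewrite def_v (reindex f); last by exists g => ? _.
  by apply: eq_bigr => j _; rewrite ffunE.
have def_c : c = [ffun x => d (g x)].
  apply: c_uniq; rewrite def_d (reindex f); last by exists g => ? _.
  by apply: eq_bigr => j _; rewrite ffunE fK.
by apply/ffunP => j; rewrite ffunE def_c ffunE fK.
Qed.

(** The base change matrices multiply to the identity, and over the integers this bounds the outer
    size by the inner one. *)
Lemma is_Zbasis_leq (V : zmodType) m n (e : 'I_m -> V) (f : 'I_n -> V) :
  is_Zbasis e -> is_Zbasis f -> (m <= n)%N.
Proof.
move=> eB fB.
have [a def_a] : exists a : 'I_m -> {ffun 'I_n -> int}, forall i, e i = \sum_j f j *~ a i j.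
  apply: (fin_all_exists (P := fun i (c : {ffun _ -> int}) => e i = \sum_j f j *~ c j)) => i.
  by have [c [? _]] := fB (e i); exists c.
have [b def_b] : exists b : 'I_n -> {ffun 'I_m -> int}, forall j, f j = \sum_i e i *~ b j i.
  apply: (fin_all_exists (P := fun j (c : {ffun _ -> int}) => f j = \sum_i e i *~ c i)) => j.
  by have [c [? _]] := eB (f j); exists c.
apply: (@mulmx1_min _ _ _ (\matrix_(i, j) a i j) (\matrix_(j, i) b j i)).
apply/matrixP => i i'; rewrite !mxE.
(* The row of the identity and the row of the product both express [e i] in the basis [e]. *)
have [c [_ c_uniq]] := eB (e i).
have c1 : c = [ffun i' => (i == i')%:R].
  apply: c_uniq; rewrite (bigD1 i) //= ffunE eqxx mulr1z big1 ?addr0 // => j ne.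
  by rewrite ffunE eq_sym (negbTE ne) mulr0z.
have c2 : c = [ffun i' => \sum_j a i j * b j i'].
  apply: c_uniq; rewrite {1}def_a; under eq_bigr => j _ do rewrite def_b mulrz_suml.
  rewrite exchange_big; apply: eq_bigr => l _ /=; rewrite ffunE mulrz_sumr.
  by apply: eq_bigr => j _; rewrite -mulrzA mulrC.
under eq_bigr => j _ do rewrite !mxE.
by move: c2; rewrite c1 => /ffunP/(_ i'); rewrite !ffunE => <-.
Qed.

Lemma free_rank_basis (I : finType) (V : zmodType) (e : I -> V) :
  is_Zbasis e -> free_rank V = #|I|.
Proof.
move=> eB; have eB' : is_Zbasis (e \o (@enum_val I xpredT)).
  by apply: is_Zbasis_reindex eB; exact: enum_val_bij.
rewrite /free_rank; case: xgetP => [d _ [f fB]|]; last by move=> /(_ #|I|) []; exists (e \o enum_val).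
by apply/eqP; rewrite eqn_leq (is_Zbasis_leq fB eB') (is_Zbasis_leq eB' fB).
Qed.

(** * Gaussian binomials and the q-Pascal recurrence *)

Section QPascal.

Variables (F : fieldType) (x : F).
Hypothesis qint_neq0 : forall m, qint x m.+1 != 0.

Lemma qintD m p : qint x (m + p) = qint x m + x ^+ m * qint x p.
Proof.
rewrite /qint big_split_ord /= mulr_sumr; congr (_ + _).
by apply: eq_bigr => i _; rewrite exprD.
Qed.

Lemma qfactS m : qfact x m.+1 = qfact x m * qint x m.+1.
Proof. by rewrite /qfact big_ord_recr. Qed.

Lemma qfact0 : qfact x 0 = 1.
Proof. by rewrite /qfact big_ord0. Qed.

Lemma qfact_neq0 m : qfact x m != 0.
Proof. by apply/prodf_neq0 => i _. Qed.

Lemma gauss_binom0 m : gauss_binom x m 0 = 1.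
Proof. by rewrite /gauss_binom subn0 qfact0 mul1r divff ?qfact_neq0. Qed.

Lemma gauss_binomn m : gauss_binom x m m = 1.
Proof. by rewrite /gauss_binom subnn qfact0 mulr1 divff ?qfact_neq0. Qed.

Lemma gauss_binomS m p : (p < m)%N ->
  gauss_binom x m.+1 p.+1 =
    x ^+ p.+1 * gauss_binom x m p.+1 + gauss_binom x m p.
Proof.
(* Writing [m] as [p.+1 + d] removes every truncated subtraction. *)
move=> /subnKC <-; set d := (m - p.+1)%N; rewrite addSn /gauss_binom.
have -> : ((p + d).+2 - p.+1 = d.+1)%N by rewrite subSS -addnS addKn.
have -> : ((p + d).+1 - p.+1 = d)%N by rewrite subSS addKn.
have -> : ((p + d).+1 - p = d.+1)%N by rewrite -addnS addKn.
(* The recurrence is this splitting of the top q-integer, up to common factors. *)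
have def_m : qint x (p + d).+2 = qint x p.+1 + x ^+ p.+1 * qint x d.+1.
  by rewrite -qintD addSn addnS.
rewrite [qfact x (p + d).+2]qfactS def_m (qfactS p) (qfactS d).
move: (qfact_neq0 p) (qfact_neq0 d) (qint_neq0 p) (qint_neq0 d).
move: (qfact x p) (qfact x d) (qint x p.+1) (qint x d.+1) (qfact _ _) => P D p' d' M.
move=> *; field.
by apply/and4P; split.
Qed.

End QPascal.

(** * Critical words by their last letter *)

Lemma rgword_rcons k t a : (0 < size t)%N ->
  rgword k (rcons t a) =
    [&& rgword (maxletter t) t, (0 < a <= (maxletter t).+1)%N
      & maxn (maxletter t) a == k].
Proof.
move=> t_gt0; rewrite /rgword size_rcons all_rcons eqxx andbT /=.
have -> : maxletter (rcons t a) = maxn (maxletter t) a.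
  by rewrite /maxletter -cats1 big_cat big_seq1.
have -> : head 0%N (rcons t a) = head 0%N t by case: t t_gt0.
have -> : iota 1 (size t) = rcons (iota 1 (size t).-1) (size t).
  by case: (size t) t_gt0 => // m _; rewrite -{1}(addn1 m) iotaD cats1 add1n.
rewrite all_rcons nth_rcons ltnn eqxx -cats1 take_size_cat //.
rewrite [X in _ && (_ && (_ && X && _))](eq_in_all
    (a2 := fun i => nth 0%N t i <= (maxletter (take i t)).+1)%N).
  by rewrite -!andbA; do ?bool_congr.
move=> i; rewrite mem_iota add1n prednK // => /andP[_ i_lt].
by rewrite nth_cat i_lt takel_cat // ltnW.
Qed.

Lemma critical_rcons t a :
  critical (rcons t a) = critical t &&
    ~~ ((a <= maxletter t)%N && (~~ odd a || (a < maxletter t)%N)).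
Proof.
rewrite /critical size_rcons -(addn1 (size t)) iotaD has_cat negb_or /= orbF add0n; congr (_ && _).
  congr (~~ _); apply: eq_in_has => i; rewrite mem_iota => /andP[_ i_lt].
  by rewrite /bad size_rcons nth_rcons i_lt ltnW // /premax -cats1 takel_cat // ltnW.
rewrite /bad size_rcons leqnn nth_rcons ltnn eqxx /=.
by rewrite /premax -cats1 take_size_cat.
Qed.

(** The last letter of a critical word is its maximum: either a new one, or a repetition, which must
    be odd. *)
Lemma critical_rgword_rcons k t a : (0 < size t)%N ->
  rgword k (rcons t a) && critical (rcons t a) =
    [&& critical t, a == k & (odd k && rgword k t) || ((0 < k)%N && rgword k.-1 t)].
Proof.
move=> t_gt0; rewrite rgword_rcons // critical_rcons.
have rgE j : rgword j t = rgword (maxletter t) t && (maxletter t == j).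
  by rewrite /rgword eqxx andbT -!andbA.
rewrite (rgE k) (rgE k.-1); case: (rgword _ t); last by rewrite /= !andbF.
case: (critical t); last by rewrite /= !andbF.
move: (maxletter t) => m /=.
apply/idP/idP => [/andP[/andP[/andP[a_gt0 a_le] /eqP <-]]|].
  rewrite negb_and negb_or negbK -ltnNge -leqNgt => /orP[lt_m|/andP[odd_a le_m]].
    have -> : a = m.+1 by apply/eqP; rewrite eqn_leq a_le.
    by rewrite (maxn_idPr (leqnSn m)) !eqxx orbT.
  rewrite (maxn_idPr le_m) eqxx odd_a a_gt0 /=.
  by lia.
case/andP=> /eqP <- /orP[/andP[odd_a /eqP ->]|/andP[a_gt0 /eqP def_m]].
  by rewrite maxnn eqxx leqnn ltnn odd_a leqnSn (odd_gt0 odd_a).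
rewrite def_m prednK // a_gt0 leqnn (maxn_idPr (leq_pred a)) eqxx /=.
by rewrite -ltnS prednK // ltnn.
Qed.

(* Indexed by the length minus one: the words have length n.+1. *)
Fixpoint critical_words (n k : nat) : seq (seq nat) :=
  if n is n'.+1 then
    (if odd k then [seq rcons t k | t <- critical_words n' k] else [::])
    ++ (if k is k'.+1 then [seq rcons t k | t <- critical_words n' k'] else [::])
  else if k == 1%N then [:: [:: 1%N]] else [::].

Lemma mem_critical_words n k s :
  (s \in critical_words n k) = [&& size s == n.+1, rgword k s & critical s].
Proof.
elim: n k s => [|n IH] k s.
  have -> : (s \in critical_words 0 k) = (k == 1%N) && (s == [:: 1%N]).
    by rewrite /=; case: ifP; rewrite ?mem_seq1 ?in_nil.
  case: s => [|a [|b s]]; rewrite ?andbF //; last by rewrite eqseq_cons /= !andbF.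
  rewrite /rgword /critical /bad /premax /maxletter /= big_seq1 big_nil.
  rewrite eqseq_cons !andbT orbF leqn0.
  by case: a => [|[|a]]; rewrite ?andbF //= ?andbT eq_sym.
case/lastP: s => [|t a].
  rewrite /= mem_cat; apply/norP; split.
    by case: ifP => // _; apply/mapP => -[[|? ?]].
  by case: k => // k; apply/mapP => -[[|? ?]].
rewrite size_rcons eqSS; case: (posnP (size t)) => [/size0nil ->|t_gt0].
  rewrite /= mem_cat; apply/norP; split.
    case: ifP => // _; apply/mapP => -[u]; rewrite IH => /andP[/eqP sz _] /(congr1 size).
    by rewrite size_rcons sz.
  case: k => // k; apply/mapP => -[u]; rewrite IH => /andP[/eqP sz _] /(congr1 size).
  by rewrite size_rcons sz.
rewrite critical_rgword_rcons //= mem_cat.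
have mem_rc b l : (rcons t a \in [seq rcons u b | u <- l]) = (a == b) && (t \in l).
  apply/mapP/andP => [[u u_l /rcons_inj[-> ->]]|[/eqP -> t_l]]; last by exists t.
  by rewrite eqxx.
rewrite (fun_if (fun l => rcons t a \in l)) mem_rc in_nil IH.
case: k => [|k] /=; first by rewrite !andbF.
rewrite mem_rc IH; case: odd => /=; case: (a == k.+1); case: (critical t); case: eqP;
  by rewrite ?andbF ?andbT.
Qed.

Lemma critical_words_uniq n k : uniq (critical_words n k).
Proof.
elim: n k => [|n IH] k /=; first by case: eqP.
have uniq_rc b l : uniq l -> uniq [seq rcons u b | u <- l].
  by rewrite map_inj_uniq // => u v /rcons_inj[].
rewrite cat_uniq; apply/and3P; split.
- by case: ifP => // _; apply: uniq_rc.
(* The two lists are disjoint, since deleting the last letter leaves words with different maxima. *)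
- case: k => // k; apply/hasPn => _ /mapP[t t_k ->]; case: ifP => // _.
  apply/negP => /mapP[u u_k /rcons_inj[eq_tu]]; move: u_k t_k.
  rewrite -eq_tu !mem_critical_words => /and3P[_ /and4P[_ _ _ /eqP max_u] _].
  by case/and3P=> _ /and4P[_ _ _ /eqP max_t] _; lia.
- by case: k => // k; apply: uniq_rc.
Qed.

Lemma critical_words_nil n k : (k == 0%N) || (n.+1 < k)%N -> critical_words n k = [::].
Proof.
elim: n k => [|n IH] [|[|k]] //=.
rewrite ltnS => lt_k; rewrite !IH //; first by case: odd.
by rewrite (ltn_trans (ltnSn _)).
Qed.

(** * The generating function of critical words by rank *)

Section CriticalSum.

Variables (R : comPzRingType) (y : R).

Definition critical_sum (n k : nat) : R :=
  \sum_(s <- critical_words n k) y ^+ (sumn s - n.+1 - 'C(k, 2)).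

(** A repeated last letter [k.+1] raises the rank by [k]. A new maximum adds nothing, as its excess
    [k] is absorbed by the growth of the binomial coefficient. *)
Lemma critical_sumS n k : critical_sum n.+1 k.+1 =
  (if odd k then 0 else y ^+ k * critical_sum n k.+1) + critical_sum n k.
Proof.
(* This bound makes the truncated subtractions in the exponents exact. *)
have sumn_ge j s : s \in critical_words n j -> (n.+1 + 'C(j, 2) <= sumn s)%N.
  by rewrite mem_critical_words => /and3P[/eqP <- /rgword_sumn].
rewrite /critical_sum big_cat big_map /=; congr (_ + _).
  case: odd; rewrite /= ?big_nil // big_map mulr_sumr.
  apply: eq_big_seq => s /sumn_ge le_s; rewrite sumn_rcons -exprD; congr (_ ^+ _).
  by lia.
apply: eq_big_seq => s /sumn_ge le_s; rewrite sumn_rcons binS bin1; congr (_ ^+ _).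
by lia.
Qed.

Lemma critical_sum0 n k : (k == 0%N) || (n.+1 < k)%N -> critical_sum n k = 0.
Proof. by move=> k_out; rewrite /critical_sum critical_words_nil ?big_nil. Qed.

End CriticalSum.

Lemma critical_sum_gauss_binom (F : fieldType) (y : F) n k :
  (forall m, qint (y ^+ 2) m.+1 != 0) -> (k <= n)%N ->
  critical_sum y n k.+1 = gauss_binom (y ^+ 2) (n - k.+1./2) k./2.
Proof.
move=> qint_neq0; elim: n k => [|n IH] k.
  rewrite leqn0 => /eqP ->; rewrite gauss_binom0 // /critical_sum big_seq1 /=.
  by rewrite bin_small.
move=> k_le; rewrite critical_sumS.
have def_k := odd_double_half k; move: (odd k) (k./2) def_k => b m def_k.
(* Odd [k] comes first: the maximum [k.+1] is even and cannot be repeated, so one term remains, with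
   the same binomial. *)
case: b def_k => /=; rewrite ?add0n ?add1n => def_k; rewrite -{}def_k in k_le *.
  rewrite add0r IH; last by lia.
  by rewrite /= uphalf_double doubleK subSS.
(* Even [k]: the maximum is odd and may be repeated. For [m = 0] it is 1, no word has maximum 0, and
   both binomials are 1. *)
rewrite /= uphalf_double; case: m k_le => [|m] k_le.
  by rewrite mul1r (critical_sum0 _ (k := 0)) // addr0 IH //= !gauss_binom0.
rewrite doubleS (IH (m.*2.+1)) /= ?doubleK; last by lia.
rewrite uphalf_double.
(* If [m.*2.+2 <= n], both terms are covered by induction and form the q-Pascal recurrence.
   Otherwise words of length [n.+1] cannot reach the maximum [m.*2.+3], and the two remaining
   binomials are 1. *)
have [le_n|lt_n] := leqP (m.*2.+2) n.
  rewrite IH //= uphalf_double doubleK subSn; last by lia.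
  by rewrite gauss_binomS //; [rewrite -exprM mul2n doubleS | lia].
rewrite critical_sum0; last by rewrite ltnS lt_n orbT.
have -> : n = m.*2.+1 by lia.
have -> : (m.*2.+2 - m.+1 = m.+1)%N by lia.
have -> : (m.*2.+1 - m.+1 = m)%N by lia.
by rewrite !gauss_binomn // mulr0 add0r.
Qed.

(** * The Poincare series *)

Lemma qint_q_neq0 m : qint (q ^+ 2) m.+1 != 0.
Proof.
have -> : qint (q ^+ 2) m.+1 = tofrac (\sum_(i < m.+1) 'X ^+ (2 * i) : {poly int}).
  by rewrite rmorph_sum; apply: eq_bigr => i _; rewrite rmorphXn -exprM.
(* The value of this polynomial at 1 is [m.+1], a nonzero integer. *)
rewrite tofrac_eq0; apply/eqP => /(congr1 (fun p => p.[1])) /eqP.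
rewrite horner_sum horner0 (eq_bigr (fun=> 1)) => [|i _]; last by rewrite hornerXn expr1n.
by rewrite sumr_const card_ord Num.Theory.pnatr_eq0.
Qed.

Lemma sum_critical_rk n k (R : comPzRingType) (y : R) :
  \sum_(w : RG n.+1 k | critical (letters w)) y ^+ rk w = critical_sum y n k.
Proof.
rewrite /critical_sum (perm_big [seq letters w | w <- enum (RG n.+1 k) & critical (letters w)]) /=.
  by rewrite big_map big_filter big_enum_cond.
rewrite perm_sym; apply: uniq_perm; rewrite ?critical_words_uniq //.
  by rewrite (map_inj_uniq (@letters_inj _ _)) filter_uniq // enum_uniq.
move=> s; rewrite mem_critical_words; apply/mapP/and3P => [[w]|[/eqP sz rg crit]].
  by rewrite mem_filter => /andP[crit _] ->; rewrite size_letters rgword_letters.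
have [w def_s] := letters_surj rg sz.
by exists w; rewrite // mem_filter def_s crit mem_enum.
Qed.

Lemma poincare_seriesE n k :
  poincare_series n k = \sum_(w : RG n k | critical (letters w)) q ^+ rk w.
Proof.
(* Critical words are grouped by rank; [inord] is exact here because no rank exceeds
   [top_rank n k]. *)
pose deg (w : RG n k) : 'I_(top_rank n k).+1 := inord (rk w).
rewrite (partition_big deg xpredT) //; apply: eq_bigr => i _.
rewrite (free_rank_basis (homology_basis (@is_cycle_incr n k i))) card_sig.
rewrite mulr_natl -sumr_const; apply: eq_big => w.
  rewrite inE incr_allowableE -val_eqE /= inordK // ltnS.
  exact: (leq_bigmax (F := @rk n k)).
by rewrite inE incr_allowableE => /andP[_ /eqP ->].
Qed.

Local Close Scope ring_scope.

Theorem theorem6p3 (n k : nat) (n_ge1 : 1 <= n) (k_bounds : 1 <= k <= n) :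
  (exists is_cycle_incr : forall (i : nat) (w : incr_allowable n k i),
       is_cycle i (elem n k (letters (val w))),
     forall i : nat,
       is_Zbasis (fun w : incr_allowable n k i =>
                    homology_class (Cycle (is_cycle_incr i w)))) /\
  poincare_series n k =
    gauss_binom (q ^+ 2)%R (n - 1 - k./2) ((k - 1)./2).
Proof.
split; first by exists (@is_cycle_incr n k) => i; apply: homology_basis.
(* Length and maximum are both shifted by one to match the indexing of
   [critical_sum_gauss_binom]. *)
case: n k n_ge1 k_bounds => // n [|k] // _ k_le.
rewrite poincare_seriesE sum_critical_rk critical_sum_gauss_binom ?subn1 //.
exact: qint_q_neq0.
Qed.
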